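(* Let $R$ be a commutative ring with identity, $M$ an $R$-module and $S$ a multiplicatively closed subset of $R$. Then: (a) If $P$ is a primary submodule of $M$ such that $(P:_R M)\cap S=\emptyset$, then $P$ is an $S$-primary submodule of $M$. (b) If $P$ is an $S$-primary submodule of $M$ and $S\subseteq u(R)$, where $u(R)$ denotes the set of units in $R$, then $P$ is a primary submodule of $M$.
   Context: All rings are commutative with identity and all modules are unital. A multiplicatively closed subset $S$ of $R$ is a non-empty subset with $0\notin S$, $1\in S$, and $ss'\in S$ for all $s,s'\in S$. $(P:_R M)=\{r\in R : rM\subseteq P\}$, and $\sqrt{I}$ is the radical of an ideal $I$. A submodule $P$ of $M$ with $(P:_R M)\cap S=\emptyset$ is called $S$-primary if there exists $s\in S$ such that whenever $rm\in P$ with $r\in R$, $m\in M$, then $sr\in\sqrt{(P:_R M)}$ or $sm\in P$. A submodule $P$ of $M$ is primary if $P\ne M$ and whenever $rm\in P$ with $r\in R$, $m\in M$, then $r\in\sqrt{(P:_R M)}$ or $m\in P$. *)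

(* Defs.v *)
From HB Require Import structures.
From mathcomp Require Import all_boot all_algebra.
From mathcomp Require Import classical_sets.

Set Implicit Arguments.
Unset Strict Implicit.
Unset Printing Implicit Defensive.

Import GRing.Theory.

Local Open Scope classical_set_scope.
Local Open Scope ring_scope.

Section RingNotions.
Context {R : comPzRingType}.

Definition mult_closed (S : set R) : Prop :=
  ~ S 0 /\ GRing.mulr_closed [in S].

(* u(R), stated without a unitRingType structure so that [R] may be an
   arbitrary commutative ring. *)
Definition ring_units : set R := [set u | exists v, u * v = 1].

Definition radical (I : set R) : set R :=
  [set r | exists n : nat, (0 < n)%N /\ I (r ^+ n)].

End RingNotions.

Section ModuleNotions.
Context {R : comPzRingType} {M : lmodType R}.

Definition submodule (P : set M) : Prop := GRing.submod_closed [in P].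

Definition colon (P : set M) : set R :=
  [set r | range (fun m : M => r *: m) `<=` P].

Definition primary (P : set M) : Prop :=
  [/\ submodule P,
      P <> setT
    & forall (r : R) (m : M), P (r *: m) -> radical (colon P) r \/ P m].

Definition S_primary (S : set R) (P : set M) : Prop :=
  [/\ submodule P,
      colon P `&` S = set0
    & exists2 s, S s &
        forall (r : R) (m : M), P (r *: m) ->
          radical (colon P) (s * r) \/ P (s *: m)].

End ModuleNotions.

(* Main.v *)
Require Import Defs.
From mathcomp Require Import all_boot all_algebra.
From mathcomp Require Import classical_sets.

Local Open Scope classical_set_scope.
Local Open Scope ring_scope.

Import GRing.Theory.

(** With witness [s = 1], the [S]-primary condition is the primary one, which gives (a). For (b),
    the witness [s] is a unit with inverse [v], so multiplying by [v] removes it from both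
    alternatives: [P] and its colon are stable under multiplication by scalars. *)

Lemma mult_closed1 (R : comPzRingType) (S : set R) : mult_closed S -> S 1.
Proof. by move=> [_ [/set_mem]]. Qed.

Lemma submodule_scale (R : comPzRingType) (M : lmodType R) (P : set M)
    (a : R) (m : M) : submodule P -> P m -> P (a *: m).
Proof.
move=> [P0 Plin] Pm; rewrite -[a *: m]addr0.
by apply/set_mem/Plin => //; exact/mem_set.
Qed.

Lemma colon_mull (R : comPzRingType) (M : lmodType R) (P : set M) (a r : R) :
  submodule P -> colon P r -> colon P (a * r).
Proof.
move=> Psub Pr _ [m _ <-]; rewrite -scalerA.
by apply: submodule_scale => //; apply: Pr; exists m.
Qed.

Lemma primary_S_primary (R : comPzRingType) (M : lmodType R) (S : set R)
    (P : set M) : S 1 -> primary P -> colon P `&` S = set0 -> S_primary S P.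
Proof.
move=> S1 [Psub _ Pprim] PS0; split=> //; exists 1 => // r m.
by rewrite mul1r scale1r; exact: Pprim.
Qed.

Lemma S_primary_units_primary (R : comPzRingType) (M : lmodType R) (S : set R)
    (P : set M) :
  S 1 -> S_primary S P -> S `<=` ring_units -> primary P.
Proof.
move=> S1 [Psub PS0 [s Ss Pprim]] /(_ s Ss)[v sv1]; split=> // [PT|r m].
  (* Properness comes from disjointness: if [P] were all of [M], its colon would be all of [R] and
     meet [S] at [1]. *)
  have: (colon P `&` S) 1 by rewrite PT.
  by rewrite PS0.
case/Pprim => [[n [n_gt0 Psrn]]|Psm]; [left|right].
  exists n; split=> //.
  (* The same exponent serves, since [r ^+ n = v ^+ n * (s * r) ^+ n]. *)
  by rewrite -[r]mul1r -sv1 (mulrC s) -mulrA exprMn; exact: colon_mull.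
(* Here [m = v *: (s *: m)]. *)
by rewrite -[m]scale1r -sv1 mulrC -scalerA; exact: submodule_scale.
Qed.

Theorem lemma2p3 (R : comPzRingType) (M : lmodType R) (S : set R)
    (S_mult : mult_closed S) :
  (forall P : set M, primary P -> colon P `&` S = set0 -> S_primary S P) /\
  (forall P : set M, S_primary S P -> S `<=` ring_units -> primary P).
Proof.
have S1 := mult_closed1 _ _ S_mult.
split=> P; [exact: primary_S_primary | exact: S_primary_units_primary].
Qed.
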